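(* Let $R$ be an extended affine root system of type $A_1$ and nullity $\nu$. Then the Weyl group $\mathcal{W}$ of $R$ is isomorphic to the group $G$ defined by generators: $x_i$, $0\leq i\leq\nu$; relations: $x_k^2=1$ for $0\leq k\leq\nu$, and $(x_0x_ix_j)^2=1$ for $1\leq i<j\leq\nu$.
   Context: Let $A$ be an abelian group with a nontrivial symmetric positive semidefinite bi-homomorphism $(\cdot,\cdot):A\times A\to\mathbb{Q}$, with radical $A^0=\{\alpha\in A:(\alpha,A)=0\}$. For $B\subseteq A$ put $B^\times=B\setminus A^0$, $B^0=B\cap A^0$. Put $(\beta,\alpha^\vee)=2(\beta,\alpha)/(\alpha,\alpha)$ if $(\alpha,\alpha)\neq0$ and $(\beta,\alpha^\vee)=0$ otherwise. A subset $R\subseteq A$ is an affine reflection system if (R1) $R=-R$; (R2) $R$ generates $A$; (R3) for $\alpha\in R^\times$, $\beta\in R$ there are $d,u\in\mathbb{Z}_{\ge0}$ with $(\beta+\mathbb{Z}\alpha)\cap R=\{\beta-d\alpha,\dots,\beta+u\alpha\}$ and $d-u=(\beta,\alpha^\vee)$. It is irreducible if $R^\times$ is not a disjoint union of two nonempty orthogonal subsets, and tame if $R^0\subseteq R^\times-R^\times$. Its type is the type of its image in $A/A^0$ (a locally finite root system); type $A_1$ means that this image is $\{0,\pm\bar\epsilon\}$. An extended affine root system of type $A_1$ and nullity $\nu$ means here a tame irreducible affine reflection system $R$ of type $A_1$ in $A$ with $\Lambda:=A^0$ free abelian of finite rank $\nu$. Equivalently, $A=\mathbb{Z}\epsilon\oplus\Lambda$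 and $R=(S+S)\cup(\{0,\pm\epsilon\}+S)$ with $S\subseteq\Lambda$ a semilattice: $0\in S$, $S\pm2S\subseteq S$, $\langle S\rangle=\Lambda$. The Weyl group $\mathcal{W}$ of $R$ is the subgroup of $\mathrm{Aut}(A)$ generated by all $w_\alpha$, $\alpha\in R$, where $w_\alpha(\beta)=\beta-(\beta,\alpha^\vee)\alpha$. *)

(* Defs.v *)
From HB Require Import structures.
From mathcomp Require Import all_boot all_order all_algebra.
From mathcomp Require Import boolp classical_sets.

Set Implicit Arguments.
Unset Strict Implicit.
Unset Printing Implicit Defensive.

Import Order.TTheory GRing.Theory Num.Theory.

Local Open Scope classical_set_scope.
Local Open Scope ring_scope.
Local Open Scope quotient_scope.

(* [isog] is unrelated to the homonymous relation on finite groups: the groups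
   here are possibly infinite [groupType]s. *)
Definition isog (G H : groupType) : Prop :=
  exists f : {multiplicative G -> H}, bijective f.

Section GeneratedSubgroup.

Variables (G : groupType) (S : set G).

Definition gen : {pred G} :=
  fun g => `[< forall H : groupClosed G, (forall s, S s -> s \in H) -> g \in H >].

Lemma genP g :
  reflect (forall H : groupClosed G, (forall s, S s -> s \in H) -> g \in H)
          (g \in gen).
Proof. exact: asboolP. Qed.

Lemma gen_group_closed : group_closed gen.
Proof.
split=> [|g h /genP Hg /genP Hh]; apply/genP => H SH; first exact: gpred1.
by apply: gpredF; [exact: Hg | exact: Hh].
Qed.

Record subgroup_gen := SubgroupGen { gen_val :> G; gen_valP : gen gen_val }.

HB.instance Definition _ := [isSub for gen_val].
HB.instance Definition _ := [Choice of subgroup_gen by <:].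
HB.instance Definition _ :=
  SubChoice_isSubGroup.Build G gen subgroup_gen gen_group_closed.

End GeneratedSubgroup.

Section Automorphisms.

Variable A : zmodType.

Record autom := Autom {
  aut_fun :> A -> A;
  aut_inv : A -> A;
  autD : {morph aut_fun : x y / x + y};
  aut_funK : cancel aut_fun aut_inv;
  aut_invK : cancel aut_inv aut_fun }.

Lemma autP (f g : autom) : f =1 g -> f = g.
Proof.
case: f g => [f f' fD fK f'K] [g g' gD gK g'K] /= /funext fg.
case: g / fg gD gK g'K => gD gK g'K.
have fg' : f' = g' by apply/funext => x; rewrite -{1}(g'K x) fK.
case: g' / fg' gK g'K => gK g'K.
by congr Autom; apply: Prop_irrelevance.
Qed.

HB.instance Definition _ := gen_eqMixin autom.
HB.instance Definition _ := gen_choiceMixin autom.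

Definition aut_one : autom :=
  @Autom id id (fun _ _ => erefl) (fun _ => erefl) (fun _ => erefl).

Lemma aut_mulD (f g : autom) : {morph f \o g : x y / x + y}.
Proof. by move=> x y /=; rewrite !autD. Qed.

Definition aut_mul (f g : autom) : autom :=
  Autom (@aut_mulD f g) (can_comp (@aut_funK f) (@aut_funK g))
        (can_comp (@aut_invK g) (@aut_invK f)).

Lemma aut_invD (f : autom) : {morph aut_inv f : x y / x + y}.
Proof.
by move=> x y; rewrite -{1}(aut_invK f x) -{1}(aut_invK f y) -autD aut_funK.
Qed.

Definition aut_inverse (f : autom) : autom :=
  Autom (@aut_invD f) (@aut_invK f) (@aut_funK f).

Lemma aut_mulA : associative aut_mul. Proof. by move=> f g h; apply/autP. Qed.
Lemma aut_mul1 : left_id aut_one aut_mul. Proof. by move=> f; apply/autP. Qed.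
Lemma aut_mulr1 : right_id aut_one aut_mul. Proof. by move=> f; apply/autP. Qed.
Lemma aut_mulV : left_inverse aut_one aut_inverse aut_mul.
Proof. by move=> f; apply/autP => x /=; rewrite aut_funK. Qed.
Lemma aut_mulrV : right_inverse aut_one aut_inverse aut_mul.
Proof. by move=> f; apply/autP => x /=; rewrite aut_invK. Qed.

HB.instance Definition _ :=
  isGroup.Build autom aut_mulA aut_mul1 aut_mulr1 aut_mulV aut_mulrV.

End Automorphisms.

(* A letter [(x, true)] stands for the generator x and [(x, false)] for x^-1. *)
Definition word (X : Type) := seq (X * bool).

HB.instance Definition _ (X : choiceType) := Choice.on (word X).

Definition letter (X : Type) (x : X) : word X := [:: (x, true)].

Definition word_inv (X : Type) (w : word X) : word X :=
  rev [seq (a.1, ~~ a.2) | a <- w].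

(* Two words are congruent when they represent the same element of the quotient
   of the free group on X by the normal closure of the relators. *)
Inductive word_congr (X : Type) (rels : set (word X)) : word X -> word X -> Prop :=
| WordRefl u : word_congr rels u u
| WordSym u v : word_congr rels u v -> word_congr rels v u
| WordTrans u v w :
    word_congr rels u v -> word_congr rels v w -> word_congr rels u w
| WordCancel u v x b : word_congr rels (u ++ [:: (x, b); (x, ~~ b)] ++ v) (u ++ v)
| WordRelator u v r : rels r -> word_congr rels (u ++ r ++ v) (u ++ v).

Section PresentedGroup.

Variables (X : choiceType) (rels : set (word X)).

Definition word_eqv : rel (word X) := fun u v => `[< word_congr rels u v >].

Lemma word_eqv_refl : reflexive word_eqv.
Proof. by move=> u; apply/asboolP; exact: WordRefl. Qed.

Lemma word_eqv_sym : symmetric word_eqv.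
Proof. by move=> u v; apply/asboolP/asboolP; exact: WordSym. Qed.

Lemma word_eqv_trans : transitive word_eqv.
Proof.
by move=> v u w /asboolP uv /asboolP vw; apply/asboolP; exact: WordTrans uv vw.
Qed.

Canonical word_equiv :=
  EquivRel word_eqv word_eqv_refl word_eqv_sym word_eqv_trans.

Definition presented := {eq_quot word_equiv}.

HB.instance Definition _ := Choice.on presented.
HB.instance Definition _ : EqQuotient _ word_eqv presented :=
  EqQuotient.on presented.

Lemma word_congr_ctx s t u v : word_congr rels u v ->
  word_congr rels (s ++ u ++ t) (s ++ v ++ t).
Proof.
elim=> {u v} [u|u v _ uv|u v w _ uv _ vw|u v x b|u v r rr].
- exact: WordRefl.
- exact: WordSym.
- exact: WordTrans uv vw.
- rewrite -!catA (catA s) (catA s); exact: WordCancel.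
- rewrite -!catA (catA s) (catA s); exact: WordRelator.
Qed.

Lemma word_congr_cat u u' v v' : word_congr rels u u' -> word_congr rels v v' ->
  word_congr rels (u ++ v) (u' ++ v').
Proof.
move=> uu' vv'; apply: (@WordTrans _ _ _ (u' ++ v)).
  exact: (@word_congr_ctx [::] v).
by have := @word_congr_ctx u' [::] _ _ vv'; rewrite !cats0.
Qed.

Lemma word_inv_cat (u v : word X) :
  word_inv (u ++ v) = word_inv v ++ word_inv u.
Proof. by rewrite /word_inv map_cat rev_cat. Qed.

Lemma word_invK : involutive (@word_inv X).
Proof.
move=> w; rewrite /word_inv map_rev revK -map_comp -[RHS]map_id.
by apply: eq_map => -[x b] /=; rewrite negbK.
Qed.

Lemma word_congr_mulV u : word_congr rels (u ++ word_inv u) [::].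
Proof.
elim: u => [|[x b] u IH]; first exact: WordRefl.
rewrite -cat1s word_inv_cat -!catA (catA u).
apply: WordTrans (word_congr_ctx [:: (x, b)] (word_inv [:: (x, b)]) IH) _.
exact: (@WordCancel _ _ [::] [::]).
Qed.

Lemma word_congr_Vmul u : word_congr rels (word_inv u ++ u) [::].
Proof. by rewrite -{2}(word_invK u); exact: word_congr_mulV. Qed.

Lemma word_congr_inv u v : word_congr rels u v ->
  word_congr rels (word_inv u) (word_inv v).
Proof.
move=> uv; apply: (@WordTrans _ _ _ (word_inv u ++ (v ++ word_inv v))).
  rewrite -[X in word_congr _ X _]cats0; apply: WordSym.
  by apply: word_congr_cat; [exact: WordRefl | exact: word_congr_mulV].
apply: (@WordTrans _ _ _ (word_inv u ++ u ++ word_inv v)).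
  by apply: word_congr_ctx; exact: WordSym.
rewrite catA; apply: (@word_congr_cat _ [::]); first exact: word_congr_Vmul.
exact: WordRefl.
Qed.

Definition pres_one : presented := \pi_presented [::].
Definition pres_mul (x y : presented) : presented :=
  \pi_presented (repr x ++ repr y).
Definition pres_inv (x : presented) : presented :=
  \pi_presented (word_inv (repr x)).

Lemma pi_eqP u v : \pi_presented u = \pi_presented v <-> word_congr rels u v.
Proof.
split=> [/eqquotP|uv]; first by move/asboolP.
by apply/eqquotP/asboolP.
Qed.

Lemma repr_congr u : word_congr rels (repr (\pi_presented u)) u.
Proof. by apply/pi_eqP; rewrite reprK. Qed.

Lemma pi_mul u v :
  pres_mul (\pi_presented u) (\pi_presented v) = \pi_presented (u ++ v).
Proof. by apply/pi_eqP; apply: word_congr_cat; exact: repr_congr. Qed.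

Lemma pi_inv u : pres_inv (\pi_presented u) = \pi_presented (word_inv u).
Proof. by apply/pi_eqP; apply: word_congr_inv; exact: repr_congr. Qed.

Lemma pres_mulA : associative pres_mul.
Proof.
move=> x y z; rewrite -(reprK x) -(reprK y) -(reprK z).
by rewrite (pi_mul (repr y)) (pi_mul (repr x) (repr y)) pi_mul pi_mul catA.
Qed.

Lemma pres_mul1 : left_id pres_one pres_mul.
Proof. by move=> x; rewrite -(reprK x) pi_mul. Qed.

Lemma pres_mulr1 : right_id pres_one pres_mul.
Proof. by move=> x; rewrite -(reprK x) pi_mul cats0. Qed.

Lemma pres_mulV : left_inverse pres_one pres_inv pres_mul.
Proof.
move=> x; rewrite -(reprK x) pi_inv pi_mul.
by apply/pi_eqP; exact: word_congr_Vmul.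
Qed.

Lemma pres_mulrV : right_inverse pres_one pres_inv pres_mul.
Proof.
move=> x; rewrite -(reprK x) pi_inv pi_mul.
by apply/pi_eqP; exact: word_congr_mulV.
Qed.

HB.instance Definition _ :=
  isGroup.Build presented pres_mulA pres_mul1 pres_mulr1 pres_mulV pres_mulrV.

End PresentedGroup.

Record psd_form (A : zmodType) := PsdForm {
  form :> A -> A -> rat;
  formDl : forall c, {morph form^~ c : a b / a + b};
  formDr : forall c, {morph form c : a b / a + b};
  formC : forall a b, form a b = form b a;
  form_ge0 : forall a, 0 <= form a a;
  form_nontrivial : exists a b, form a b != 0 }.

Section AffineReflectionSystems.

Variables (A : zmodType) (form : psd_form A).

Definition radical : {pred A} := fun a => `[< forall b, form a b = 0 >].

Lemma radicalP a : reflect (forall b, form a b = 0) (a \in radical).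
Proof. exact: asboolP. Qed.

Lemma form0l b : form 0 b = 0.
Proof. by apply: (addrI (form 0 b)); rewrite -formDl !addr0. Qed.

Lemma formNl a b : form (- a) b = - form a b.
Proof. by apply: (addrI (form a b)); rewrite -formDl !subrr form0l. Qed.

Lemma radical_zmod_closed : zmod_closed radical.
Proof.
split=> [|a b /radicalP ra /radicalP rb]; apply/radicalP => c.
  exact: form0l.
by rewrite formDl formNl ra rb subr0.
Qed.

HB.instance Definition _ := GRing.isZmodClosed.Build A radical radical_zmod_closed.

Definition nonisotropic (B : set A) : set A := [set a | B a /\ a \notin radical].
Definition isotropic (B : set A) : set A := [set a | B a /\ a \in radical].

Definition cartan (b a : A) : rat :=
  if form a a != 0 then 2%:R * form b a / form a a else 0.

Definition generates (R : set A) : Prop :=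
  forall B : zmodClosed A, (forall a, R a -> a \in B) -> forall a, a \in B.

Record is_affine_reflection_system (R : set A) : Prop := {
  ars_opp : R = [set - a | a in R];
  ars_gen : generates R;
  ars_string : forall a b, nonisotropic R a -> R b -> exists d u : nat,
    [set b + a *~ n | n in [set: int]] `&` R =
      [set b + a *~ n | n in [set n : int | - d%:Z <= n <= u%:Z]]
    /\ d%:R - u%:R = cartan b a }.

Definition orthogonal_sets (B C : set A) : Prop :=
  forall b c, B b -> C c -> form b c = 0.

Definition is_irreducible (R : set A) : Prop :=
  ~ exists R1 R2 : set A,
      [/\ nonisotropic R = R1 `|` R2, R1 `&` R2 = set0,
          R1 !=set0, R2 !=set0 & orthogonal_sets R1 R2].

Definition is_tame (R : set A) : Prop :=
  isotropic R `<=` [set a - b | a in nonisotropic R & b in nonisotropic R].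

Definition of_type_A1 (R : set A) : Prop :=
  exists e : {ideal_quot radical},
    e != 0 /\ [set \pi_{ideal_quot radical} a | a in R] = [set 0; e; - e].

Definition radical_free_of_rank (nu : nat) : Prop :=
  exists f : {additive 'rV[int]_nu -> A},
    injective f /\ [set a | a \in radical] = range f.

Record is_EARS_A1 (R : set A) (nu : nat) : Prop := {
  ears_ars : is_affine_reflection_system R;
  ears_irreducible : is_irreducible R;
  ears_tame : is_tame R;
  ears_type : of_type_A1 R;
  ears_nullity : radical_free_of_rank nu }.

(* The floor only converts the pairing, which is integral for a in an affine
   reflection system (cartan_int), from rat to int. *)
Definition reflection (a b : A) : A := b - a *~ Num.floor (cartan b a).

(* By reflection_autom no reflection of an affine reflection system is lost. *)
Definition reflections (R : set A) : set (autom A) :=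
  [set g : autom A | exists2 a, R a & g =1 reflection a].

Definition Weyl_group (R : set A) := subgroup_gen (reflections R).

HB.instance Definition _ (R : set A) := Choice.on (Weyl_group R).
HB.instance Definition _ (R : set A) := Group.on (Weyl_group R).

Lemma cartanD a : {morph cartan^~ a : b c / b + c}.
Proof.
move=> b c; rewrite /cartan; case: ifP => _; last by rewrite addr0.
by rewrite formDl mulrDr mulrDl.
Qed.

Lemma cartan0 a : cartan 0 a = 0.
Proof. by apply: (addrI (cartan 0 a)); rewrite -cartanD !addr0. Qed.

Lemma cartanN b a : cartan (- b) a = - cartan b a.
Proof. by apply: (addrI (cartan b a)); rewrite -cartanD !subrr cartan0. Qed.

Lemma cartanMz b a (n : int) : cartan (b *~ n) a = n%:~R * cartan b a.
Proof.
have E (m : nat) : cartan (b *+ m) a = m%:R * cartan b a.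
  elim: m => [|m IH]; first by rewrite mulr0n cartan0 mul0r.
  by rewrite mulrSr cartanD IH mulrSr mulrDl mul1r.
by case: n => m; rewrite ?NegzE ?mulrNz ?cartanN -!pmulrn E ?mulNr.
Qed.

Lemma cartan_int R a b :
  is_affine_reflection_system R -> R a -> cartan b a \is a Num.int.
Proof.
move=> [_ Rgen Rstr] Ra.
pose B : {pred A} := fun b => cartan b a \is a Num.int.
have Bz : zmod_closed B.
  split=> [|x y xB yB]; first by rewrite /B -topredE /= cartan0 rpred0.
  by rewrite /B -topredE /= cartanD cartanN rpredB.
pose Bc : zmodClosed A :=
  HB.pack_for (zmodClosed A) B (GRing.isZmodClosed.Build A B Bz).
apply: (Rgen Bc) => c Rc; rewrite -topredE /= /B.
have [aa|aa] := eqVneq (form a a) 0; first by rewrite /B /cartan aa eqxx rpred0.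
have nia : nonisotropic R a.
  by split=> //; apply/radicalP => /(_ a) /eqP; rewrite (negPf aa).
have [d [u [_ <-]]] := Rstr _ _ nia Rc.
by rewrite rpredB // rpred_nat.
Qed.

Lemma reflection_autom R a : is_affine_reflection_system R -> R a ->
  exists g : autom A, g =1 reflection a.
Proof.
move=> Rars Ra.
have fl b : (Num.floor (cartan b a))%:~R = cartan b a.
  by apply/eqP; rewrite -intrEfloor; exact: cartan_int Rars Ra.
have D : {morph reflection a : x y / x + y}.
  move=> x y; rewrite /reflection addrACA -opprD -mulrzDr; congr (_ - _ *~ _).
  by apply: (@intr_inj rat); rewrite intrD !fl cartanD.
have K : cancel (reflection a) (reflection a).
  move=> b; rewrite {1}/reflection -[RHS](subrK (a *~ Num.floor (cartan b a))).
  congr (_ + _); rewrite -mulrNz; congr (_ *~ _).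
  apply: (@intr_inj rat); rewrite rmorphN /= !fl /reflection cartanD cartanN.
  rewrite cartanMz fl {3}/cartan.
  case: eqVneq => [aa|aa] /=.
    by rewrite /cartan aa eqxx /= mul0r subr0 oppr0.
  by rewrite mulfK // mulr_natr mulr2n opprB addrK.
by exists (Autom D K K).
Qed.

End AffineReflectionSystems.

Definition A1_relators (nu : nat) : set (word 'I_nu.+1) :=
  [set r | (exists k : 'I_nu.+1, r = letter k ++ letter k) \/
           (exists i j : 'I_nu.+1, (1 <= i < j)%N /\
              let w := letter ord0 ++ letter i ++ letter j in r = w ++ w)].

Definition A1_group (nu : nat) := presented (@A1_relators nu).
HB.instance Definition _ (nu : nat) := Group.on (A1_group nu).

(* Main.v *)
(* Fix a root a0, let c(b) = <b, a0^vee>, and let f : Z^nu -> A be a basis of the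
   radical. Every nonisotropic root is, up to sign, a0 + s with s in the radical,
   and its reflection is b |-> b - c(b) (a0 + s). Since c(a0) = 2 and c vanishes on
   the radical, these reflections compose like the point reflections v |-> s - v,
   so they act through the generalised dihedral group Z^nu x| {1, -1}. Tameness makes
   the nonisotropic roots generate A, hence the differences of the s exhaust the
   radical and the Weyl group is all of Z^nu x| {1, -1}.
   In the presented group put t_i = x_i x_0: the relation (x_0 x_i x_j)^2 = 1 says
   exactly that t_i and t_j commute, and x_0 inverts every t_i, which presents the
   same group. *)
From HB Require Import structures.
Require Import Defs.
From mathcomp Require Import all_boot all_order all_algebra.
From mathcomp Require Import boolp classical_sets.

Set Implicit Arguments.
Unset Strict Implicit.
Unset Printing Implicit Defensive.

Import Order.TTheory GRing.Theory Num.Theory.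
Local Open Scope ring_scope.

(** * Isomorphisms, and subgroups generated by a set *)

Section Isog.

Lemma isogI (G H : groupType) (f : G -> H) :
  {morph f : x y / (x * y)%g} -> bijective f -> isog G H.
Proof.
move=> fM fb.
by exists (HB.pack_for {multiplicative G -> H} f (isMultiplicative.Build G H f fM)).
Qed.

Lemma isog_sym (G H : groupType) : isog G H -> isog H G.
Proof.
case=> f [g fK gK]; apply: (@isogI _ _ g); last by exists f.
exact: can2_gmulfM.
Qed.

Lemma isog_trans (G H K : groupType) : isog G H -> isog H K -> isog G K.
Proof.
case=> f fb [g gb]; apply: (@isogI _ _ (g \o f)); last exact: bij_comp.
exact: gmulfM.
Qed.

Lemma sub_gen (G : groupType) (S : set G) g : S g -> g \in gen S.
Proof. by move=> Sg; apply/genP => H; apply. Qed.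

HB.instance Definition _ (G : groupType) (S : set G) :=
  isMulClosed.Build G (gen S) (group_closedM (@gen_group_closed G S)).
HB.instance Definition _ (G : groupType) (S : set G) :=
  isMul1Closed.Build G (gen S) (@gen_group_closed G S).1.
HB.instance Definition _ (G : groupType) (S : set G) :=
  isInvClosed.Build G (gen S) (group_closedV (@gen_group_closed G S)).

Lemma morph_mul1 (G H : groupType) (f : G -> H) :
  {morph f : x y / (x * y)%g} -> f 1%g = 1%g.
Proof. by move=> fM; apply: (mulgI (f 1%g)); rewrite -fM !mulg1. Qed.

Lemma morph_mulF (G H : groupType) (f : G -> H) :
  {morph f : x y / (x * y)%g} -> {morph f : x y / (x / y)%g}.
Proof. by move=> fM x y; apply: (mulIg (f y)); rewrite -fM !mulgVK. Qed.

Lemma morph_mulV (G H : groupType) (f : G -> H) :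
  {morph f : x y / (x * y)%g} -> {morph f : x / (x^-1)%g}.
Proof.
move=> fM x; apply: (mulgI (f x)); rewrite -fM !mulgV; exact: morph_mul1.
Qed.

(** The image of [M] is a subgroup containing [S], hence contains everything generated by [S]; the
    last hypothesis gives the other inclusion. The inverse map chooses preimages, which injectivity
    makes unique. *)
Lemma isog_gen (D G : groupType) (M : D -> G) (S : set G) :
  {morph M : x y / (x * y)%g} -> injective M -> (forall g, S g -> exists d, M d = g) ->
  (forall d, M d \in gen S) -> isog D (subgroup_gen S).
Proof.
move=> MM Minj SM MS.
apply: (@isogI _ _ (fun d => Sub (M d) (MS d) : subgroup_gen S)).
  by move=> x y; apply: val_inj; rewrite valM !SubK MM.
pose im : {pred G} := fun g => `[< exists d, M d = g >].
have imP : group_closed im.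
  split=> [|g h /asboolP[d <-] /asboolP[d' <-]]; apply/asboolP.
    by exists 1%g; rewrite (morph_mul1 MM).
  by exists (d / d')%g; rewrite (morph_mulF MM).
pose imH : groupClosed G := HB.pack_for (groupClosed G) im
  (isMulClosed.Build G im (group_closedM imP))
  (isMul1Closed.Build G im imP.1)
  (isInvClosed.Build G im (group_closedV imP)).
have im_gen (w : subgroup_gen S) : exists d, M d = gen_val w.
  have imS s : S s -> s \in imH by move=> Ss; apply/asboolP; exact: SM.
  exact: asboolW (elimT (genP S _) (gen_valP w) imH imS).
exists (fun w => sval (cid (im_gen w))) => [d|w].
  by apply: Minj; case: cid.
by apply: val_inj; rewrite SubK; case: cid.
Qed.

End Isog.

(** * The generalised dihedral group of an abelian group *)

Section Dihedral.

Variable V : zmodType.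

(* The pair [(s, v)] stands for the map x |-> v + x of V when [s] is false, and
   for x |-> v - x when [s] is true. *)
Definition dihedral : Type := (bool * V)%type.

HB.instance Definition _ := Choice.on dihedral.

Implicit Types d : dihedral.

Definition dihedral_one : dihedral := (false, 0).
Definition dihedral_mul d d' : dihedral :=
  (d.1 (+) d'.1, if d.1 then d.2 - d'.2 else d.2 + d'.2).
Definition dihedral_inv d : dihedral := (d.1, if d.1 then d.2 else - d.2).

Lemma dihedral_mulA : associative dihedral_mul.
Proof.
move=> [[] u] [[] v] [[] w]; rewrite /dihedral_mul /= ?opprD ?opprK ?addrA //.
Qed.

Lemma dihedral_mul1 : left_id dihedral_one dihedral_mul.
Proof. by move=> [[] v]; rewrite /dihedral_mul /= add0r. Qed.

Lemma dihedral_mulr1 : right_id dihedral_one dihedral_mul.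
Proof. by move=> [[] v]; rewrite /dihedral_mul /= ?subr0 ?addr0. Qed.

Lemma dihedral_mulV : left_inverse dihedral_one dihedral_inv dihedral_mul.
Proof. by move=> [[] v]; rewrite /dihedral_mul /= ?subrr ?addNr. Qed.

Lemma dihedral_mulrV : right_inverse dihedral_one dihedral_inv dihedral_mul.
Proof. by move=> [[] v]; rewrite /dihedral_mul /= subrr. Qed.

HB.instance Definition _ := isGroup.Build dihedral dihedral_mulA dihedral_mul1
  dihedral_mulr1 dihedral_mulV dihedral_mulrV.

Lemma dihedralM d d' :
  (d * d')%g = (d.1 (+) d'.1, if d.1 then d.2 - d'.2 else d.2 + d'.2) :> dihedral.
Proof. by []. Qed.

End Dihedral.

(** * Integer powers in a group *)

Section IntegerPowers.

Local Open Scope group_scope.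

Variable G : groupType.
Implicit Types (x y : G) (m n : int).

Definition expgz x n : G := match n with Posz k => x ^+ k | Negz k => x ^- k.+1 end.

Lemma expgzS x n : expgz x (1 + n)%R = x * expgz x n.
Proof.
case: n => [n|[|n]]; first by rewrite -expgS.
  by rewrite NegzE subrr /= mulgV.
have -> : (1 + Negz n.+1)%R = Negz n.
  by rewrite !NegzE [n.+2%:Z]intS opprD addrA subrr add0r.
by rewrite /= -!expVgn [in RHS]expgS mulVKg.
Qed.

Lemma expgzD x m n : expgz x (m + n)%R = expgz x m * expgz x n.
Proof.
elim/int_rect: m => [|m IH|m IH]; first by rewrite add0r mul1g.
  by rewrite intS -addrA !expgzS IH mulgA.
(* Multiplying by [x] raises the exponent -(m + 1) to -m, where the induction hypothesis applies. *)
apply: (mulgI x); rewrite mulgA -!expgzS intS opprD !addrA subrr add0r.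
exact: IH.
Qed.

Lemma commute_expgz x y n : commute x y -> commute x (expgz y n).
Proof.
by move=> xy; case: n => n /=; [apply: commuteX | apply/commuteV/commuteX].
Qed.

(** The hypothesis says that conjugation by [y^-1] inverts [x]; conjugation is a morphism, so it
    inverts all powers of [x]. *)
Lemma expgzN_conj x y n : y * x = x^-1 * y -> y * expgz x n = expgz x (- n)%R * y.
Proof.
move=> yx.
have E : x ^ y^-1 = x^-1 by rewrite conjgE invgK mulgA yx mulgK.
suff <- : expgz x n ^ y^-1 = expgz x (- n)%R by rewrite -conjgCV.
case: n => [[|n]|n].
- by rewrite conj1g.
- by rewrite -NegzE /= conjXg E expVgn.
- by rewrite NegzE opprK /= conjVg conjXg E expVgn invgK.
Qed.

End IntegerPowers.

Lemma morph_expgz (G H : groupType) (f : G -> H) x n :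
  {morph f : x y / (x * y)%g} -> f (expgz x n) = expgz (f x) n.
Proof.
move=> fM.
have fX k : (f (x ^+ k) = f x ^+ k)%g.
  by elim: k => [|k IH]; [exact: morph_mul1 | rewrite !expgS fM IH].
by case: n => n; rewrite /= ?(morph_mulV fM) fX.
Qed.

(** * Homomorphisms out of the dihedral group of a lattice *)

Section DihedralHom.

Local Open Scope group_scope.

Variables (G : groupType) (n : nat) (y : G) (t : 'I_n -> G).
Hypotheses (yy : y * y = 1) (tC : forall i j, commute (t i) (t j)).
Hypothesis yt : forall i, y * t i = (t i)^-1 * y.

Definition lattice_hom (v : 'rV[int]_n) : G := \prod_(i < n) expgz (t i) (v ord0 i).

Lemma lattice_homD u v : lattice_hom (u + v)%R = lattice_hom u * lattice_hom v.
Proof.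
rewrite /lattice_hom -prodgM_commute.
  by apply: eq_bigr => i _; rewrite mxE expgzD.
move=> i j _ _; exact/commute_expgz/commute_sym/commute_expgz/tC.
Qed.

Lemma lattice_homN v : y * lattice_hom v = lattice_hom (- v)%R * y.
Proof.
rewrite /lattice_hom; elim: (index_enum _) => [|i s IH].
  by rewrite !big_nil mulg1 mul1g.
by rewrite !big_cons mulgA expgzN_conj // -mulgA IH mulgA mxE.
Qed.

Lemma lattice_hom0 : lattice_hom 0 = 1.
Proof. by rewrite /lattice_hom big1 // => i _; rewrite mxE. Qed.

(** The factors live in a possibly noncommutative group, so the product is followed in its order:
    along the duplicate-free index list, only the factor at [i] has a nonzero exponent. *)
Lemma lattice_hom_delta i : lattice_hom (delta_mx ord0 i) = t i.
Proof.
rewrite /lattice_hom.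
have: i \in index_enum 'I_n by rewrite mem_index_enum.
have: uniq (index_enum 'I_n) by exact: index_enum_uniq.
elim: (index_enum _) => // j s IH /= /andP[js us]; rewrite inE big_cons mxE /=.
case: eqVneq => [->|ij] /= => [_|ins].
  rewrite big_seq big1 ?mulg1 ?expg1 // => k ks; rewrite mxE /=.
  by case: eqVneq => // kj; rewrite -kj ks in js.
by rewrite mul1g IH.
Qed.

(** Every [(true, v)] is [(false, v)] times [(true, 0)], so a morphism is determined by its values
    on translations and on the point reflection at the origin, which goes to [y]. *)
Definition dihedral_hom (d : dihedral 'rV[int]_n) : G :=
  lattice_hom d.2 * (if d.1 then y else 1).

Lemma dihedral_homM : {morph dihedral_hom : d d' / d * d'}.
Proof.
move=> [[] u] [s v]; rewrite dihedralM /dihedral_hom /=; last first.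
  by rewrite lattice_homD !mulg1 !mulgA.
rewrite lattice_homD -!mulgA; congr (_ * _); rewrite mulgA lattice_homN -mulgA.
by case: s; rewrite /= ?yy ?mulg1.
Qed.

End DihedralHom.

(** * The universal property of a presented group *)

Section Presentation.

Local Open Scope group_scope.

Variables (X : choiceType) (rels : set (word X)).

Definition word_eval (G : groupType) (f : X -> G) (w : word X) : G :=
  \prod_(a <- w) (if a.2 then f a.1 else (f a.1)^-1).

Lemma word_eval_morph (G H : groupType) (g : G -> H) (f : X -> G) w :
  {morph g : x y / x * y} -> g (word_eval f w) = word_eval (g \o f) w.
Proof.
move=> gM; rewrite /word_eval (big_morph g gM (morph_mul1 gM)).
by apply: eq_bigr => -[x []] _ //=; rewrite (morph_mulV gM).
Qed.

Definition pres_gen (x : X) : presented rels := (\pi_(presented rels) (letter x))%qT.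

Lemma word_eval_pres_gen w : word_eval pres_gen w = (\pi_(presented rels) w)%qT.
Proof.
have piM u v : (\pi_(presented rels) (u ++ v) =
    \pi_(presented rels) u * \pi_(presented rels) v)%qT by rewrite -Defs.pi_mul.
elim: w => [|[x b] w IH]; first by rewrite /word_eval big_nil.
rewrite /word_eval big_cons [X in _ * X]IH -cat1s piM; congr (_ * _).
by case: b => //=; rewrite /pres_gen [LHS]Defs.pi_inv.
Qed.

Variables (G : groupType) (f : X -> G).
Hypothesis f_rels : forall r, rels r -> word_eval f r = 1.

(** Cancelling pairs evaluate to 1 in any group and relators do so by [f_rels]. This makes
    [pres_hom] independent of the chosen representative. *)
Lemma word_eval_congr u v : word_congr rels u v -> word_eval f u = word_eval f v.
Proof.
elim=> {u v} [//|u v _ -> //|u v w _ -> _ -> //|u v x b|u v r rr].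
  rewrite /word_eval !big_cat /= !big_cons big_nil; congr (_ * _).
  by case: b; rewrite /= mulg1 ?mulgV ?mulVg mul1g.
by rewrite /word_eval !big_cat /= [X in _ * (X * _)](f_rels rr) mul1g.
Qed.

Definition pres_hom (g : presented rels) : G := word_eval f (repr g).

Lemma pres_hom_pi w : pres_hom (\pi_(presented rels) w)%qT = word_eval f w.
Proof. exact/word_eval_congr/repr_congr. Qed.

Lemma pres_homM : {morph pres_hom : g h / g * h}.
Proof.
move=> g h; rewrite [X in pres_hom X = _](_ : _ = pres_mul g h) //.
by rewrite /pres_mul pres_hom_pi /word_eval big_cat.
Qed.

End Presentation.

(** * The presented group is the dihedral group of the lattice *)

Section A1Group.

Local Open Scope group_scope.

Variable nu : nat.

Notation dih := (dihedral 'rV[int]_nu).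
Notation x := (@pres_gen _ (@A1_relators nu) : 'I_nu.+1 -> A1_group nu).

Lemma A1_relator_eq1 r : A1_relators r -> word_eval x r = 1.
Proof.
move=> rr; rewrite word_eval_pres_gen; apply/pi_eqP.
by have := WordRelator [::] [::] rr; rewrite cats0.
Qed.

Lemma A1_gen_sq k : x k * x k = 1.
Proof.
have /A1_relator_eq1 : A1_relators (letter k ++ letter k) by left; exists k.
by rewrite /word_eval !big_cons big_nil mulg1.
Qed.

Lemma A1_genV k : (x k)^-1 = x k. Proof. exact/mulg1_eq/A1_gen_sq. Qed.

(** The index is shifted by one: [lift ord0 i] is the generator numbered i + 1, so the nonzero
    generators match the standard basis of the lattice. *)
Definition A1_trans (i : 'I_nu) := x (lift ord0 i) * x ord0.

Lemma A1_transV i : (A1_trans i)^-1 = x ord0 * x (lift ord0 i).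
Proof. by rewrite invgM !A1_genV. Qed.

Lemma A1_gen0_trans i : x ord0 * A1_trans i = (A1_trans i)^-1 * x ord0.
Proof. by rewrite A1_transV mulgA. Qed.

(* The relator (x_0 x_i x_j)^2 is t_i^-1 t_j t_i t_j^-1 for t_i = x_i x_0. *)
Lemma A1_trans_commute i j : commute (A1_trans i) (A1_trans j).
Proof.
wlog ij : i j / (i < j)%N => [H|].
  by case: (ltngtP i j) => [/H //|/H/commute_sym //|/val_inj ->]; exact: commute_refl.
pose i' := lift ord0 i; pose j' := lift ord0 j.
have /A1_relator_eq1 : A1_relators (let w := letter ord0 ++ letter i' ++ letter j'
    in w ++ w) by right; exists i', j'.
rewrite /word_eval !big_cons big_nil mulg1 /= => rel.
have E : A1_trans j * (A1_trans i * (A1_trans j)^-1) = A1_trans i.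
  apply: (mulgI (A1_trans i)^-1); rewrite mulVg -[RHS]rel !A1_transV /A1_trans.
  by rewrite -!mulgA (mulgA (x ord0) (x ord0)) A1_gen_sq mul1g.
by rewrite /commute -[X in X * _ = _]E -!mulgA mulVg mulg1.
Qed.

(** The point reflections v |-> -v for [x ord0] and v |-> e_i - v for the others; hence [A1_trans i]
    corresponds to the translation by e_i. *)
Definition dihedral_gen (k : 'I_nu.+1) : dih :=
  (true, if unlift ord0 k is Some i then delta_mx ord0 i else 0%R).

(** Each relator is the square of a word of length 1 or 3. A product of an odd number of point
    reflections is again a point reflection, hence an involution. *)
Lemma dihedral_gen_rels r : A1_relators r -> word_eval dihedral_gen r = 1.
Proof.
have sq (d : dih) : d.1 -> d * d = 1.
  by case: d => -[] //= v _; rewrite dihedralM /= subrr.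
case=> [[k ->]|[i [j [_ ->]]]]; apply: etrans (big_cat _ _ _ _ _) _; apply: sq.
  by rewrite big_cons big_nil.
by rewrite !big_cons big_nil.
Qed.

Definition A1_of_dihedral : dih -> A1_group nu := dihedral_hom (x ord0) A1_trans.
Definition dihedral_of_A1 : A1_group nu -> dih := pres_hom dihedral_gen.

Lemma A1_of_dihedralM : {morph A1_of_dihedral : d d' / d * d'}.
Proof.
apply: dihedral_homM; [exact: A1_gen_sq | exact: A1_trans_commute|].
exact: A1_gen0_trans.
Qed.

Lemma dihedral_of_A1M : {morph dihedral_of_A1 : g h / g * h}.
Proof. exact/pres_homM/dihedral_gen_rels. Qed.

Lemma A1_of_dihedral_gen k : A1_of_dihedral (dihedral_gen k) = x k.
Proof.
rewrite /A1_of_dihedral /dihedral_hom /=; case: unliftP => [i|] ->.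
  by rewrite lattice_hom_delta -mulgA A1_gen_sq mulg1.
by rewrite lattice_hom0 mul1g.
Qed.

Lemma dihedral_of_A1_gen k : dihedral_of_A1 (x k) = dihedral_gen k.
Proof.
rewrite /dihedral_of_A1 pres_hom_pi; last exact: dihedral_gen_rels.
by rewrite /word_eval big_cons big_nil mulg1.
Qed.

Lemma dihedral_of_A1K : cancel dihedral_of_A1 A1_of_dihedral.
Proof.
move=> g; rewrite -(reprK g) /dihedral_of_A1 pres_hom_pi; last exact: dihedral_gen_rels.
rewrite (word_eval_morph _ _ A1_of_dihedralM) -word_eval_pres_gen.
by congr word_eval; apply/funext => k; exact: A1_of_dihedral_gen.
Qed.

Lemma expgz_trans (v : 'rV[int]_nu) n :
  expgz ((false, v) : dih) n = (false, v *~ n)%R.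
Proof.
have E k : ((false, v) : dih) ^+ k = (false, v *+ k)%R.
  by elim: k => // k IH; rewrite expgS IH dihedralM /= mulrS.
by case: n => n /=; rewrite E ?NegzE ?mulrNz.
Qed.

(** On translations, [v] is expanded in the standard basis and each power of [A1_trans i] is sent to
    the matching multiple of e_i; the factor [x ord0] then accounts for the boolean. *)
Lemma A1_of_dihedralK : cancel A1_of_dihedral dihedral_of_A1.
Proof.
have h1 := morph_mul1 dihedral_of_A1M.
have E v : dihedral_of_A1 (lattice_hom A1_trans v) = (false, v).
  rewrite /lattice_hom (big_morph _ dihedral_of_A1M h1).
  rewrite (eq_bigr (fun i => (false, v ord0 i *: delta_mx ord0 i)%R : dih)).
    rewrite [in RHS](row_sum_delta v).
    by elim/big_ind2: _ => // u u' w w' -> ->.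
  move=> i _.
  have -> : dihedral_of_A1 (expgz (A1_trans i) (v ord0 i)) =
            expgz (dihedral_of_A1 (A1_trans i)) (v ord0 i).
    exact/morph_expgz/dihedral_of_A1M.
  rewrite /A1_trans dihedral_of_A1M !dihedral_of_A1_gen.
  rewrite dihedralM /dihedral_gen /= liftK unlift_none subr0 expgz_trans.
  by rewrite -scaler_int intz.
move=> [s v]; rewrite /A1_of_dihedral /dihedral_hom dihedral_of_A1M E.
case: s => /=; last by rewrite h1 dihedralM /= addr0.
by rewrite dihedral_of_A1_gen dihedralM /dihedral_gen unlift_none /= addr0.
Qed.


Lemma isog_dihedral_A1 : isog dih (A1_group nu).
Proof.
apply: (@isogI _ _ A1_of_dihedral); first exact: A1_of_dihedralM.
by exists dihedral_of_A1; [exact: A1_of_dihedralK | exact: dihedral_of_A1K].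
Qed.

End A1Group.

(** * The Weyl group is the dihedral group of the radical *)

Section Weyl.

Local Open Scope classical_set_scope.

Variables (A : zmodType) (form : psd_form A) (R : set A).

(** Elements satisfying [P] form a subgroup containing [R]; this turns [generates] into an induction
    principle. *)
Lemma generates_ind (P : A -> Prop) : generates R -> P 0 ->
  (forall a b, P a -> P b -> P (a - b)) -> (forall a, R a -> P a) -> forall a, P a.
Proof.
move=> Rgen P0 PB PR a.
pose p : {pred A} := fun a => `[< P a >].
have pz : zmod_closed p.
  by split=> [|x y /asboolP Px /asboolP Py]; apply/asboolP => //; exact: PB.
pose B : zmodClosed A := HB.pack_for (zmodClosed A) p (GRing.isZmodClosed.Build A p pz).
have Ba : a \in B by apply: Rgen => b Rb; apply/asboolP; exact: PR.
exact: asboolW Ba.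
Qed.

Lemma reflectionE a b n : cartan form b a = n%:~R -> reflection form a b = b - a *~ n.
Proof. by rewrite /reflection => ->; rewrite intrKfloor. Qed.

Lemma form0r a : form a 0 = 0. Proof. by rewrite Defs.formC Defs.form0l. Qed.

Lemma formNr a b : form a (- b) = - form a b.
Proof. by rewrite Defs.formC Defs.formNl Defs.formC. Qed.

Lemma form_radr a b : b \in radical form -> form a b = 0.
Proof. by move/radicalP => rb; rewrite Defs.formC. Qed.

Lemma of_type_A1_root : of_type_A1 form R -> exists2 a0, nonisotropic form R a0 &
  forall a, nonisotropic form R a ->
    a - a0 \in radical form \/ a + a0 \in radical form.
Proof.
case=> e [e0 eR].
have : [set \pi_{ideal_quot (radical form)}%qT a | a in R] e by rewrite eR; left; right.
case=> a0 Ra0 ea0.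
have rad_pi a : (a \in radical form) = (\pi_{ideal_quot (radical form)}%qT a == 0).
  by rewrite -[a in LHS]subr0 Quotient.idealrBE raddf0.
exists a0 => [|a [Ra]]; first by split; rewrite // rad_pi ea0.
rewrite !rad_pi raddfB raddfD /= ea0 => /eqP api.
have : [set 0; e; - e] (\pi_{ideal_quot (radical form)}%qT a) by rewrite -eR; exists a.
case=> [[//|->]|->]; first by left; rewrite subrr.
by right; rewrite addNr.
Qed.

(** Modulo the radical every root is 0 or a0 up to sign. If a0 had norm 0, it would be orthogonal to
    all roots, hence to [A], and lie in the radical. *)
Lemma root_norm_neq0 a0 : generates R -> nonisotropic form R a0 ->
  (forall a, nonisotropic form R a ->
     a - a0 \in radical form \/ a + a0 \in radical form) ->
  form a0 a0 != 0.
Proof.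
move=> Rgen [_ a0rad] Ra0; apply: contra a0rad => /eqP a00; apply/radicalP.
apply: (generates_ind Rgen); first exact: form0r.
  by move=> a b a0a a0b; rewrite Defs.formDr formNr a0a a0b subrr.
move=> a Ra; have [/form_radr //|ra] := boolP (a \in radical form).
have [/form_radr|/form_radr] := Ra0 a (conj Ra ra) => /(_ a0).
  by rewrite Defs.formDr formNr a00 subr0.
by rewrite Defs.formDr a00 addr0.
Qed.

Variables (nu : nat) (a0 : A) (f : {additive 'rV[int]_nu -> A}).
Hypotheses (Rars : is_affine_reflection_system form R) (Rtame : is_tame form R).
Hypotheses (Ra0 : R a0) (a00 : form a0 a0 != 0).
Hypotheses (f_inj : injective f) (f_rad : forall v, f v \in radical form).
Hypothesis R_a0 : forall a, nonisotropic form R a ->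
  exists v, a = a0 + f v \/ a = - (a0 + f v).

Notation dih := (dihedral 'rV[int]_nu).
Implicit Types d : dih.

Definition root_coef (b : A) : int := Num.floor (cartan form b a0).
Local Notation c := root_coef.

Lemma root_coefE b : (c b)%:~R = cartan form b a0.
Proof. by apply/eqP; rewrite -intrEfloor; exact: cartan_int Rars Ra0. Qed.

Lemma root_coefD : {morph c : a b / a + b}.
Proof. by move=> a b; apply: (@intr_inj rat); rewrite intrD !root_coefE cartanD. Qed.

Lemma root_coefN : {morph c : a / - a}.
Proof. by move=> a; apply: (@intr_inj rat); rewrite rmorphN /= !root_coefE cartanN. Qed.

Lemma root_coefMz a n : c (a *~ n) = n * c a.
Proof. by apply: (@intr_inj rat); rewrite intrM !root_coefE cartanMz. Qed.

Lemma root_coef_root : c a0 = 2.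
Proof. by apply: (@intr_inj rat); rewrite root_coefE /cartan a00 mulfK. Qed.

Lemma root_coef_rad v : c (f v) = 0.
Proof.
apply: (@intr_inj rat); rewrite root_coefE /cartan a00.
by have /radicalP -> := f_rad v; rewrite mulr0 mul0r.
Qed.

(* [(false, v)] acts as b |-> b + <b, a0^vee> f(v) and [(true, v)] as the reflection
   in a0 + f(v). *)
Definition dihedral_shift d : A := if d.1 then - (a0 + f d.2) else f d.2.
Definition dihedral_act d (b : A) : A := b + dihedral_shift d *~ c b.

Lemma root_coef_shift d : c (dihedral_shift d) = if d.1 then - 2 else 0.
Proof.
rewrite /dihedral_shift; case: ifP => _; last exact: root_coef_rad.
by rewrite root_coefN root_coefD root_coef_root root_coef_rad.
Qed.

(** With s and s' the shifts of [d] and [d'], composing the actions gives b + c(b) (s' + (1 + c(s'))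
    s), and 1 + c(s') is -1 or 1 according to [d'.1]. *)
Lemma dihedral_shiftM d d' : dihedral_shift (d * d')%g =
  dihedral_shift d' + (if d'.1 then - dihedral_shift d else dihedral_shift d).
Proof.
case: d d' => [s u] [s' v]; rewrite dihedralM /dihedral_shift.
case: s s' => -[] /=; rewrite ?(raddfB f) ?(raddfD f).
- by rewrite opprK [RHS]addrC [a0 + f u]addrC opprD addrA addrK.
- by rewrite addrA opprB.
- by rewrite -opprD -addrA [f v + _]addrC.
- by rewrite addrC.
Qed.

Lemma dihedral_actM d d' b :
  dihedral_act (d * d')%g b = dihedral_act d (dihedral_act d' b).
Proof.
rewrite /dihedral_act root_coefD root_coefMz root_coef_shift dihedral_shiftM -addrA.
rewrite mulrzDl; case: ifP => _; last by rewrite mulr0 addr0.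
by rewrite mulrN mulr_natr mulr2n opprD [c b + _]addrA subrr add0r mulrNz mulNrz.
Qed.

Lemma dihedral_actD d : {morph dihedral_act d : a b / a + b}.
Proof. by move=> a b; rewrite /dihedral_act root_coefD mulrzDr addrACA. Qed.

Lemma dihedral_act1 b : dihedral_act 1%g b = b.
Proof. by rewrite /dihedral_act /dihedral_shift /= raddf0 mul0rz addr0. Qed.

Lemma dihedral_actK d : cancel (dihedral_act d) (dihedral_act d^-1%g).
Proof. by move=> b; rewrite -dihedral_actM mulVg dihedral_act1. Qed.

Lemma dihedral_actVK d : cancel (dihedral_act d^-1%g) (dihedral_act d).
Proof. by move=> b; rewrite -dihedral_actM mulgV dihedral_act1. Qed.

Definition dihedral_autom d : autom A :=
  Autom (@dihedral_actD d) (@dihedral_actK d) (@dihedral_actVK d).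
Local Notation M := dihedral_autom.

Lemma dihedral_automM : {morph M : d d' / (d * d')%g}.
Proof. by move=> d d'; apply: autP => b; exact: dihedral_actM. Qed.

(** Evaluation at a0 yields twice the shift, because c(a0) = 2. Applying c separates reflections
    from translations; then [f_inj] and the absence of 2-torsion in the lattice recover the
    vector. *)
Lemma dihedral_autom_inj : injective M.
Proof.
have double_inj : injective (fun v : 'rV[int]_nu => v *~ 2).
  move=> u v /matrixP uv; apply/matrixP => i j.
  by have := uv i j; rewrite -!pmulrn !mulmxnE => /pmulrnI ->.
move=> d d' /(congr1 (fun g : autom A => g a0)) /=.
rewrite /dihedral_act root_coef_root => /addrI E.
have := congr1 c E; rewrite !root_coefMz !root_coef_shift.
case: d d' E => [s u] [s' v] /=; rewrite /dihedral_shift /=.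
case: s s' => -[] //= + _; last by rewrite -!raddfMz => /f_inj/double_inj ->.
rewrite !mulNrz => /oppr_inj; rewrite !mulrzDl => /addrI.
by rewrite -!raddfMz => /f_inj/double_inj ->.
Qed.

(** Adding a radical vector to a0 changes no pairing, and replacing a root by its opposite does not
    change its reflection. *)
Lemma reflection_root v a : a = a0 + f v \/ a = - (a0 + f v) ->
  M (true, v) =1 reflection form a.
Proof.
have formv b : form b (a0 + f v) = form b a0.
  by rewrite Defs.formDr (form_radr _ (f_rad v)) addr0.
have cv b : cartan form b (a0 + f v) = (c b)%:~R.
  by rewrite root_coefE /cartan formv Defs.formC !formv Defs.formC.
move=> av b; rewrite /= /dihedral_act /dihedral_shift /=; case: av => ->.
  by rewrite (reflectionE (cv b)) mulNrz.
rewrite (@reflectionE _ _ (- c b)) ?mulrNz ?mulNrz ?opprK //.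
rewrite -cv /cartan Defs.formNl !formNr opprK.
by case: ifP => _; rewrite ?oppr0 // mulrN mulNr.
Qed.

Lemma dihedral_autom_reflection g : reflections form R g -> exists d, M d = g.
Proof.
case=> a Ra ga; have [ra|ra] := boolP (a \in radical form).
  (* An isotropic root has norm 0, so [cartan] takes its default value 0 and the reflection is the
     identity. *)
  exists 1%g; apply: autP => b; rewrite ga /= dihedral_act1.
  rewrite (@reflectionE _ _ 0) ?subr0 //.
  by rewrite /cartan (form_radr a ra) eqxx.
have [v av] := R_a0 (conj Ra ra).
by exists (true, v); apply: autP => b; rewrite ga; exact: reflection_root av b.
Qed.

Lemma dihedral_autom_gen d : M d \in gen (reflections form R).
Proof.
have Mrefl v a : R a -> a = a0 + f v \/ a = - (a0 + f v) ->
    M (true, v) \in gen (reflections form R).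
  by move=> Ra av; apply: sub_gen; exists a => //; exact: reflection_root av.
have M0 : M (true, 0) \in gen (reflections form R).
  by apply: Mrefl Ra0 _; left; rewrite raddf0 addr0.
(* A point reflection is a translation followed, on the right, by the reflection in a0, so only
   translations remain. *)
suff Mtrans v : M (false, v) \in gen (reflections form R).
  case: d => -[] v //.
  have -> : (true, v) = (((false, v) : dih) * ((true, 0%R) : dih))%g
    by rewrite dihedralM /= addr0.
  by rewrite dihedral_automM gpredM.
(* [P] holds when the radical part of some expression of [a] gives a translation in the Weyl group.
   It is stable under differences, so it can be spread from the roots to all of [A]. *)
pose P a := exists n v, a = a0 *~ n + f v /\ M (false, v) \in gen (reflections form R).
have P0 : P 0.
  exists 0, 0; split; first by rewrite raddf0 addr0.
  by rewrite (morph_mul1 dihedral_automM) gpred1.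
have PB a b : P a -> P b -> P (a - b).
  move=> [m [u [-> uM]]] [n [w [-> wM]]]; exists (m - n), (u - w); split.
    by rewrite mulrzBr raddfB opprD addrACA.
  have -> : (false, u - w) = (((false, u) : dih) / ((false, w) : dih))%g by [].
  by rewrite (morph_mulF dihedral_automM) gpredF.
have PR a : nonisotropic form R a -> P a.
  move=> Ra; have [w aw] := R_a0 Ra; have Mw := Mrefl _ _ Ra.1 aw.
  case: aw => ->.
    exists 1, w; split=> //.
    have -> : (false, w) = (((true, w) : dih) * ((true, 0%R) : dih))%g
      by rewrite dihedralM /= subr0.
    by rewrite dihedral_automM gpredM.
  (* For a negative root both coordinates change sign, and the two reflections are multiplied in the
     opposite order. *)
  exists (- 1), (- w); split; first by rewrite mulrNz raddfN opprD.
  have -> : (false, - w) = (((true, 0%R) : dih) * ((true, w) : dih))%g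
    by rewrite dihedralM /= sub0r.
  by rewrite dihedral_automM gpredM.
have [n [w [vw Mw]]] : P (f v).
  apply: (generates_ind (ars_gen Rars)) => // a Ra.
  have [ra|ra] := boolP (a \in radical form); last exact: PR.
  (* Tameness writes an isotropic root as a difference of nonisotropic ones. *)
  by have [b /PR Pb [b' /PR Pb' <-]] := Rtame (conj Ra ra); exact: PB.
(* Applying c to [vw] gives 0 = 2n, so [w] is [v] itself. *)
suff n0 : n = 0 by rewrite n0 add0r in vw; rewrite (f_inj vw).
have := congr1 c vw; rewrite root_coefD root_coefMz !root_coef_rad root_coef_root.
by rewrite addr0 => /esym/eqP; rewrite mulf_eq0 orbF => /eqP.
Qed.

Lemma isog_dihedral_Weyl : isog dih (Weyl_group form R).
Proof.
exact: isog_gen dihedral_automM dihedral_autom_inj dihedral_autom_reflection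
  dihedral_autom_gen.
Qed.

End Weyl.

Theorem theorem4p4 (A : zmodType) (form : psd_form A) (R : set A) (nu : nat) :
  is_EARS_A1 form R nu -> isog (Weyl_group form R) (A1_group nu).
Proof.
case=> Rars _ Rtame /of_type_A1_root[a0 Ra0 R_a0] [f [f_inj f_rad]].
have rad_f a : (a \in radical form) = range f a :> Prop by rewrite -f_rad.
apply: isog_trans (isog_dihedral_A1 nu); apply: isog_sym.
apply: (@isog_dihedral_Weyl _ _ _ _ a0 f) => // [||v|a /R_a0].
- exact: Ra0.1.
- exact: root_norm_neq0 (ars_gen Rars) Ra0 R_a0.
- by rewrite rad_f; exists v.
rewrite !rad_f => -[] [v _ E].
  by exists v; left; rewrite E addrC subrK.
(* From a + a0 = f(v) follows a = -(a0 + f(-v)), whence the sign of the witness. *)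
by exists (- v); right; rewrite raddfN E opprB addrK.
Qed.
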